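(* Let $n\ge 1$ be an integer, let $G_1,G_2$ be compact (Hausdorff) groups, let $H_1$ be a closed subgroup of $G_1$ and $H_2$ a closed subgroup of $G_2$. If $(H_1,G_1)$ and $(H_2,G_2)$ are relatively $n$-isoclinic, then $d^{(n)}(H_1,G_1)=d^{(n)}(H_2,G_2)$.
   Context: Commutators: $[x,y]=x^{-1}y^{-1}xy$ and, for $m\ge 2$, $[x_1,\dots,x_{m+1}]=[[x_1,\dots,x_m],x_{m+1}]$ (left-normed). $Z_n(G)$ denotes the $n$-th term of the upper central series of $G$ ($Z_0(G)=1$, $Z_{i+1}(G)/Z_i(G)=Z(G/Z_i(G))$). For a subgroup $H\le G$, $[_nH,G]$ is the subgroup generated by all $[h_1,\dots,h_n,g]$ with $h_i\in H$, $g\in G$. For a compact group $G$, $\mu_G$ denotes its normalized Haar measure ($\mu_G(G)=1$), and $\mu_G^m$ the product measure on $G^m$. For a closed subgroup $H$ of a compact group $G$, set $D_{n+1}=\{(h_1,\dots,h_n,g)\in H^n\times G : [h_1,\dots,h_n,g]=1\}$ and define the relative $n$-th nilpotency degree $d^{(n)}(H,G)=(\mu_H^n\times\mu_G)(D_{n+1})$. Relative $n$-isoclinism: for groups $G_1,G_2$ and subgroups $H_i\le G_i$, $(H_1,G_1)$ and $(H_2,G_2)$ are relatively $n$-isoclinic if there is a pair $(\alpha,\beta)$ such that: (i) $\alpha: G_1/Z_n(G_1)\to G_2/Z_n(G_2)$ is an isomorphism whose restriction maps $H_1Z_n(G_1)/Z_n(G_1)$ (identified with $H_1/(Z_n(G_1)\cap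 H_1)$) isomorphically onto $H_2Z_n(G_2)/Z_n(G_2)$ (identified with $H_2/(Z_n(G_2)\cap H_2)$); (ii) $\beta:[_nH_1,G_1]\to[_nH_2,G_2]$ is an isomorphism; (iii) for all $h_1,\dots,h_n\in H_1$ and $g\in G_1$, $\beta([h_1,\dots,h_n,g])=[k_1,\dots,k_n,g']$ whenever $k_i\in H_2$ with $k_iZ_n(G_2)=\alpha(h_iZ_n(G_1))$ and $g'\in G_2$ with $g'Z_n(G_2)=\alpha(gZ_n(G_1))$; i.e. $\gamma(n,H_2,G_2)\circ\alpha^{n+1}=\beta\circ\gamma(n,H_1,G_1)$, where $\gamma(n,H,G)$ sends $(h_1(Z_n(G)\cap H),\dots,h_n(Z_n(G)\cap H),gZ_n(G))\mapsto[h_1,\dots,h_n,g]$ and $\alpha^{n+1}$ is the induced map on $(n+1)$-tuples. In the setting of compact groups the isomorphisms $\alpha,\beta$ are understood as isomorphisms of topological groups (quotients and subgroups carrying the induced topologies). *)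

(* Defs.v *)
From HB Require Import structures.
From mathcomp Require Import all_boot all_order all_algebra.
From mathcomp Require Import all_classical all_reals all_analysis.
Set Implicit Arguments. Unset Strict Implicit. Unset Printing Implicit Defensive.
Import Order.TTheory GRing.Theory Num.Theory.
Local Open Scope classical_set_scope.
Local Open Scope ring_scope.

Record group_ops (T : Type) := GroupOps {
  gmul : T -> T -> T; ginv : T -> T; gone : T }.

Section Groups.
Variables (T : Type) (o : group_ops T).
Local Notation "x * y" := (gmul o x y).
Local Notation "x ^-1" := (ginv o x).
Local Notation "1" := (gone o).

Definition is_group : Prop :=
  [/\ forall x y z, x * (y * z) = (x * y) * z,
      forall x, 1 * x = x, forall x, x * 1 = x,
      forall x, x^-1 * x = 1 & forall x, x * x^-1 = 1].

Definition is_subgroup (H : set T) : Prop :=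
  [/\ H 1, forall x y, H x -> H y -> H (x * y) & forall x, H x -> H (x^-1)].

Definition gen_subgroup (S : set T) : set T :=
  fun x => forall K, is_subgroup K -> S `<=` K -> K x.

Definition comm (x y : T) : T := x^-1 * y^-1 * x * y.

Definition commn (hs : seq T) (g : T) : T :=
  match hs with
  | [::] => g
  | h :: t => foldl comm h (rcons t g)
  end.

Fixpoint upper_central (i : nat) : set T :=
  match i with
  | 0%N => [set 1]
  | i'.+1 => [set x | forall y, upper_central i' (comm x y)]
  end.

Fixpoint all_in (H : set T) (s : seq T) : Prop :=
  match s with [::] => True | x :: s' => H x /\ all_in H s' end.

Definition commH (n : nat) (H : set T) : set T :=
  gen_subgroup [set c | exists hs g, [/\ size hs = n, all_in H hs & c = commn hs g]].

Definition cong_mod (N : set T) (x y : T) : Prop := N (x^-1 * y).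

Definition saturated (N : set T) (V : set T) : Prop :=
  forall x y, cong_mod N x y -> V x -> V y.

End Groups.

Definition compact_group (T : ptopologicalType) (o : group_ops T) : Prop :=
  [/\ is_group o, hausdorff_space T, compact [set: T],
      continuous (fun p : T * T => gmul o p.1 p.2) & continuous (ginv o)].

Definition borelT (T : ptopologicalType) := g_sigma_algebraType (@open T).

Section Haar.
Variables (R : realType) (T : ptopologicalType) (o : group_ops T).
Local Open Scope ereal_scope.

Definition radon (mu : {measure set (borelT T) -> \bar R}) : Prop :=
  (forall B : set (borelT T), measurable B ->
     mu B = ereal_inf [set mu U | U in [set U : set T | open U /\ B `<=` U]]) /\
  (forall U : set T, open U ->
     mu U = ereal_sup [set mu K | K in [set K : set T | compact K /\ K `<=` U]]).

(* normalized Haar measure of the closed subgroup H, viewed as a Borel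
   measure on the ambient group concentrated on H *)
Definition haar_on (H : set T) (mu : {measure set (borelT T) -> \bar R}) : Prop :=
  [/\ radon mu, mu [set: borelT T] = 1, mu (~` H) = 0 &
      forall (x : T) (B : set (borelT T)), H x -> measurable B ->
        mu [set gmul o x b | b in B] = mu B].

Fixpoint iint (H : set T) (muH : {measure set (borelT T) -> \bar R}) (k : nat)
    (F : seq T -> \bar R) : \bar R :=
  match k with
  | 0%N => F [::]
  | k'.+1 => \int[muH]_(h in H) iint H muH k' (fun s => F (h :: s))
  end.

(* d^(n)(H,G) = (mu_H^n x mu_G)(D_{n+1}), computed as an iterated integral *)
Definition rel_nilp_degree (n : nat) (H : set T)
    (muH muG : {measure set (borelT T) -> \bar R}) : \bar R :=
  iint H muH n (fun hs => muG [set g : borelT T | commn o hs g = gone o]).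

End Haar.

(* alpha : G1/Z_n(G1) -> G2/Z_n(G2) is represented by a lift alpha : G1 -> G2
   (alpha(x Z1) = alpha x Z2); the quotient topology on G/Z is the one whose
   open sets are the images of the open Z-saturated subsets of G.
   beta : [_nH1,G1] -> [_nH2,G2] is represented by beta : G1 -> G2 with
   inverse beta' : G2 -> G1 on these subgroups (subspace topologies). *)
Definition rel_n_isoclinic (n : nat) (T1 T2 : ptopologicalType)
    (o1 : group_ops T1) (H1 : set T1) (o2 : group_ops T2) (H2 : set T2) : Prop :=
  let Z1 := upper_central o1 n in
  let Z2 := upper_central o2 n in
  let C1 := commH o1 n H1 in
  let C2 := commH o2 n H2 in
  exists (alpha : T1 -> T2) (beta : T1 -> T2) (beta' : T2 -> T1),
  [/\
    (* (i) alpha is a well defined bijective homomorphism G1/Z1 -> G2/Z2 *)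
    [/\ forall x y, cong_mod o1 Z1 x y <-> cong_mod o2 Z2 (alpha x) (alpha y),
        forall y, exists x, cong_mod o2 Z2 (alpha x) y &
        forall x y, cong_mod o2 Z2 (alpha (gmul o1 x y))
                                   (gmul o2 (alpha x) (alpha y))],
    (* ... mapping H1Z1/Z1 onto H2Z2/Z2 *)
    (forall h, H1 h -> exists2 k, H2 k & cong_mod o2 Z2 (alpha h) k) /\
    (forall k, H2 k -> exists2 h, H1 h & cong_mod o2 Z2 (alpha h) k),
    (* ... which is a homeomorphism for the quotient topologies *)
    (forall V : set T2, open V -> saturated o2 Z2 V -> open (alpha @^-1` V)) /\
    (forall U : set T1, open U -> saturated o1 Z1 U ->
       open [set y | exists2 x, U x & cong_mod o2 Z2 (alpha x) y]),
    [/\ forall x, C1 x -> C2 (beta x),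
        forall y, C2 y -> C1 (beta' y),
        forall x, C1 x -> beta' (beta x) = x,
        forall y, C2 y -> beta (beta' y) = y &
        forall x y, C1 x -> C1 y -> beta (gmul o1 x y) = gmul o2 (beta x) (beta y)] /\
    ({within C1, continuous beta} /\ {within C2, continuous beta'}) &
    forall (hs : seq T1) (g : T1) (ks : seq T2) (g' : T2),
      size hs = n -> size ks = n -> all_in H1 hs -> all_in H2 ks ->
      (forall i, (i < n)%N ->
         cong_mod o2 Z2 (alpha (nth (gone o1) hs i)) (nth (gone o2) ks i)) ->
      cong_mod o2 Z2 (alpha g) g' ->
      beta (commn o1 hs g) = commn o2 ks g'].

(* Main.v *)
Require Import Defs.
From HB Require Import structures.
From mathcomp Require Import all_boot all_order all_algebra finmap.
From mathcomp Require Import all_classical all_reals all_analysis.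
From mathcomp Require Import measurable_realfun lra.
Set Implicit Arguments. Unset Strict Implicit. Unset Printing Implicit Defensive.
Import Order.TTheory GRing.Theory Num.Theory.
Import HBNNSimple.
Local Open Scope classical_set_scope.
Local Open Scope ring_scope.

(** [alpha] is encoded as the relation [rho x y] : "alpha (x Z_n(G1)) = y Z_n(G2)".
    It is compatible with the group laws, is total on both sides (also between
    [H1] and [H2]), and sends closed sets to closed sets in both directions.

    Uniqueness of Haar measure is proved on sets, along [rho]: if [S] is closed,
    [U] open, and [S `<=` U], averaging finitely many translates gives
    [mu1 A <= mu2 (U^-1)] whenever [rho] maps the closed set [A] into [S]. Using
    this twice (for [rho] and, on complements, for equality on [G2]) gives
    [mu1 A <= mu2 V] for every open [V] containing [rho A], hence
    [mu1 A <= mu2 (rho A)] by outer regularity. Inner regularity then shows that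
    lower integrals of [rho]-related functions agree, measurable or not, so the
    iterated integrals can be compared one variable at a time. For the innermost
    measure, [beta] shows that [rho] relates the sets [{g | [h_1,...,h_n,g] = 1}]
    of both groups. *)

(** * Groups and the upper central series *)

Section GroupTheory.
Context {T : Type} {o : group_ops T}.
Hypothesis grp : is_group o.
Local Notation "x * y" := (gmul o x y).
Local Notation "x ^-1" := (ginv o x).
Local Notation "1" := (gone o).

Lemma gmulA x y z : x * y * z = x * (y * z).
Proof. by case: grp => ->. Qed.
Lemma g1mul x : 1 * x = x. Proof. by case: grp. Qed.
Lemma gmul1 x : x * 1 = x. Proof. by case: grp. Qed.
Lemma gVmul x : x^-1 * x = 1. Proof. by case: grp. Qed.
Lemma gmulV x : x * x^-1 = 1. Proof. by case: grp. Qed.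
Lemma gKmul x y : x^-1 * (x * y) = y.
Proof. by rewrite -gmulA gVmul g1mul. Qed.
Lemma gVKmul x y : x * (x^-1 * y) = y.
Proof. by rewrite -gmulA gmulV g1mul. Qed.
Lemma ginv_uniq x y : x * y = 1 -> y = x^-1.
Proof. by move=> xy1; rewrite -(gKmul x y) xy1 gmul1. Qed.
Lemma ginvK x : x^-1^-1 = x.
Proof. by apply/esym/ginv_uniq; rewrite gVmul. Qed.
Lemma ginvM x y : (x * y)^-1 = y^-1 * x^-1.
Proof. by apply/esym/ginv_uniq; rewrite gmulA gVKmul gmulV. Qed.
Lemma ginv1 : 1^-1 = 1.
Proof. by apply/esym/ginv_uniq; rewrite g1mul. Qed.

Definition group_simp := (gmulA, g1mul, gmul1, gVmul, gmulV, gKmul, gVKmul,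
  ginvM, ginvK, ginv1).

Definition normal_subgroup (N : set T) :=
  is_subgroup o N /\ forall x y, N x -> N (y^-1 * x * y).

(** Closure under products and conjugation are carried through one induction, because the identity
    [[xx',y] = [x,y]^x' [x',y]] already needs the previous term to be normal. Inverses and
    conjugates use [[x^-1,y] = ([x,y]^-1)^(x^-1)] and [[x^g,y] = [x, g y g^-1]^g]. *)
Lemma upper_central_normal n : normal_subgroup (upper_central o n).
Proof.
elim: n => [|n [[Z1 ZM ZV] ZJ]] /=.
  split=> [|x y ->]; last by rewrite /= !group_simp.
  by split=> [//|x y -> ->|x ->] /=; rewrite !group_simp.
split=> [|x g Zx y] /=.
  split=> [y|x x' Zx Zx' y|x Zx y].
  - by rewrite /comm !group_simp.
  - have -> : comm o (x * x') y = x'^-1 * comm o x y * x' * comm o x' y.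
      by rewrite /comm !group_simp.
    exact/ZM/Zx'/ZJ/Zx.
  - have -> : comm o x^-1 y = x^-1^-1 * (comm o x y)^-1 * x^-1.
      by rewrite /comm !group_simp.
    exact/ZJ/ZV/Zx.
have -> : comm o (g^-1 * x * g) y = g^-1 * comm o x (g * y * g^-1) * g.
  by rewrite /comm !group_simp.
exact/ZJ/Zx.
Qed.

Section Congruence.
Context {N : set T}.
Hypothesis nN : normal_subgroup N.

Lemma cong_mod_refl x : cong_mod o N x x.
Proof. by rewrite /cong_mod gVmul; case: nN => -[]. Qed.

Lemma cong_mod_sym x y : cong_mod o N x y -> cong_mod o N y x.
Proof.
rewrite /cong_mod; case: nN => -[_ _ NV] _ /NV.
by rewrite !group_simp.
Qed.

Lemma cong_mod_trans y x z :
  cong_mod o N x y -> cong_mod o N y z -> cong_mod o N x z.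
Proof.
rewrite /cong_mod; case: nN => -[_ NM _] _ xy yz.
by have := NM _ _ xy yz; rewrite !group_simp.
Qed.

Lemma cong_modM x x' y y' : cong_mod o N x y -> cong_mod o N x' y' ->
  cong_mod o N (x * x') (y * y').
Proof.
rewrite /cong_mod; case: nN => -[_ NM _] NJ xy xy'.
by have := NM _ _ (NJ _ x' xy) xy'; rewrite !group_simp.
Qed.

End Congruence.
End GroupTheory.

(** * Topological groups and the Borel sigma-algebra *)

Section CompactGroup.
Context {T : ptopologicalType} {o : group_ops T}.
Hypothesis cgG : compact_group o.
Let grp : is_group o. Proof. by case: cgG. Qed.

Lemma continuous_gmul {X : topologicalType} (f g : X -> T) :
  continuous f -> continuous g -> continuous (fun x => gmul o (f x) (g x)).
Proof.
move=> cf cg x; case: cgG => _ _ _ cM _.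
apply: (@continuous_comp _ _ _ (fun x => (f x, g x))
  (fun p : T * T => gmul o p.1 p.2)); last exact: cM.
by apply: cvg_pair; [exact: cf|exact: cg].
Qed.

Lemma continuous_ginv {X : topologicalType} (f : X -> T) :
  continuous f -> continuous (fun x => ginv o (f x)).
Proof.
move=> cf x; case: cgG => _ _ _ _ cV.
by apply: (@continuous_comp _ _ _ f (ginv o)); [exact: cf|exact: cV].
Qed.

Lemma continuous_gmull x : continuous (gmul o x).
Proof.
by apply: (@continuous_gmul _ (cst x) id) => y; [exact: cvg_cst|exact: cvg_id].
Qed.

Lemma continuous_comm x : continuous (comm o x).
Proof.
rewrite /comm; do !apply: continuous_gmul; do ?apply: continuous_ginv;
  by move=> z; first [exact: cvg_cst|exact: cvg_id].
Qed.

Lemma continuous_comml y : continuous (comm o ^~ y).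
Proof.
rewrite /comm; do !apply: continuous_gmul; do ?apply: continuous_ginv;
  by move=> z; first [exact: cvg_cst|exact: cvg_id].
Qed.

Lemma compact_group_closed (A : set T) : compact A -> closed A.
Proof. by case: cgG => _ hT _ _ _; exact: compact_closed. Qed.

Lemma compact_group_compact (A : set T) : closed A -> compact A.
Proof.
by case: cgG => _ _ cT _ _ clA; apply: subclosed_compact clA cT _.
Qed.

Lemma closed_gone : closed [set gone o].
Proof. by apply: compact_group_closed; exact: compact_set1. Qed.

(** Each term is an intersection of preimages of the previous one under the continuous maps [x ->
    [x,y]]. *)
Lemma upper_central_closed n : closed (upper_central o n).
Proof.
elim: n => [|n IHn] /=; first exact: closed_gone.
have -> : [set x | forall y, upper_central o n (comm o x y)] =
    \bigcap_y ((comm o ^~ y) @^-1` upper_central o n).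
  by apply/seteqP; split=> x Zx y; [move=> _|]; exact: Zx.
apply: closed_bigI => y _; apply: preimage_closed IHn => x _.
exact: continuous_comml.
Qed.

(** The set is the product [AN], the image of the compact set [A x N] under multiplication. *)
Lemma closed_cong_mod (N A : set T) : closed N -> closed A ->
  closed [set x | exists2 a, A a & cong_mod o N a x].
Proof.
move=> clN clA; apply: compact_group_closed.
have -> : [set x | exists2 a, A a & cong_mod o N a x] =
    [set gmul o p.1 p.2 | p in A `*` N].
  apply/seteqP; split=> [x [a Aa Nax]|_ [[a z] [/= Aa Nz] <-]].
    by exists (a, gmul o (ginv o a) x) => //=; rewrite !(group_simp grp).
  by exists a => //; rewrite /cong_mod !(group_simp grp).
apply: continuous_compact.
  by apply: continuous_subspaceT; case: cgG.
by apply: compact_setX; exact: compact_group_compact.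
Qed.

Lemma closed_commn_eq1 (hs : seq T) : closed [set g | commn o hs g = gone o].
Proof.
case: hs => [|h t]; rewrite /commn; first exact: closed_gone.
have -> : [set g | foldl (comm o) h (rcons t g) = gone o] =
    (comm o (foldl (comm o) h t)) @^-1` [set gone o].
  by apply/seteqP; split=> g /=; rewrite foldl_rcons.
by apply: preimage_closed closed_gone => x _; exact: continuous_comm.
Qed.

End CompactGroup.

Section Borel.
Context {T : ptopologicalType}.

Lemma open_borel (A : set (borelT T)) : @open T A -> measurable A.
Proof. by move=> oA; exact: sub_sigma_algebra. Qed.

Lemma closed_borel (A : set (borelT T)) : @closed T A -> measurable A.
Proof.
move=> clA; rewrite -[A]setCK; apply: measurableC; apply: open_borel.
exact: closed_openC.
Qed.

End Borel.

(** * Haar measures *)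

Section Haar.
Context {R : realType} {T : ptopologicalType} {o : group_ops T}.
Context {H : set T} {mu : {measure set (borelT T) -> \bar R}}.
Hypotheses (cgG : compact_group o) (sgH : is_subgroup o H) (clH : closed H).
Hypothesis haar_mu : haar_on o H mu.
Let grp : is_group o. Proof. by case: cgG. Qed.
Local Open Scope ereal_scope.

Lemma haar_le1 (B : set (borelT T)) : measurable B -> mu B <= 1.
Proof. by case: haar_mu => _ <- _ _ mB; apply: le_measure; rewrite ?inE. Qed.

Lemma haar_fin_num (B : set (borelT T)) : measurable B -> mu B \is a fin_num.
Proof.
move=> mB; rewrite ge0_fin_numE//; apply: le_lt_trans (haar_le1 mB) _.
exact: ltry.
Qed.

Lemma haar_setC (B : set (borelT T)) : measurable B -> mu (~` B) = 1 - mu B.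
Proof.
move=> mB; case: haar_mu => _ <- _ _; rewrite -setTD measureD// ?setTI//.
by rewrite -ge0_fin_numE// haar_fin_num.
Qed.

Lemma haar_supp (B : set (borelT T)) : measurable B -> H `<=` B -> mu B = 1.
Proof.
move=> mB HB; have : mu (~` B) = 0.
  case: haar_mu => _ _ H0 _; apply/eqP; rewrite eq_le measure_ge0 andbT -H0.
  apply: le_measure; rewrite ?inE; [exact: measurableC| |exact: subsetC].
  by apply: measurableC; exact: closed_borel.
rewrite haar_setC// => /eqP; rewrite sube_eq ?add0e// => /eqP <-//.
Qed.

Lemma haar_setIH (B : set (borelT T)) : measurable B -> mu (B `&` H) = mu B.
Proof.
move=> mB; have mH : measurable (H : set (borelT T)) by exact: closed_borel.
rewrite [RHS](measureDI mu mB mH) [X in X + _](_ : _ = 0) ?add0e//.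
case: haar_mu => _ _ H0 _; apply/eqP; rewrite eq_le measure_ge0 andbT -H0.
by apply: le_measure; rewrite ?inE//; [exact: measurableD|exact: measurableC].
Qed.

Lemma haar_outer (B : set (borelT T)) (e : R) : measurable B -> (0 < e)%R ->
  exists U : set T, [/\ open U, B `<=` U & mu U < mu B + e%:E].
Proof.
move=> mB e0; case: haar_mu => -[outer _] _ _ _.
have := haar_fin_num mB; rewrite outer// => Bfin.
by have [_ [U [oU BU] <-] muU] := lb_ereal_inf_adherent e0 Bfin; exists U.
Qed.

(** [radon] gives inner regularity on open sets only. For Borel sets it follows by taking
    complements in outer regularity, the total mass being 1. *)
Lemma haar_inner (B : set (borelT T)) (e : R) : measurable B -> (0 < e)%R ->
  exists K : set T, [/\ closed K, K `<=` B & mu B <= mu K + e%:E].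
Proof.
move=> mB e0; have mBC := measurableC mB.
have [U [oU BU muU]] := haar_outer mBC e0.
have mU : measurable (U : set (borelT T)) by exact: open_borel.
exists (~` U); split; [exact: open_closedC|by rewrite -[B]setCK; exact: subsetC|].
move: muU; rewrite !haar_setC//.
move: (haar_fin_num mU) (haar_fin_num mB) => /fineK <- /fineK <-.
by rewrite -!EFinB -!EFinD lte_fin lee_fin => ?; lra.
Qed.

Lemma measurable_gmul_image x (A : set T) : closed A ->
  measurable (gmul o x @` A : set (borelT T)).
Proof.
move=> clA; have -> : gmul o x @` A = gmul o (ginv o x) @^-1` A.
  apply/seteqP; split=> [_ [b Ab <-]|b Ab] /=; first by rewrite (gKmul grp).
  by exists (gmul o (ginv o x) b) => //; rewrite (gVKmul grp).
apply: closed_borel; apply: preimage_closed clA => ? _.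
exact: (continuous_gmull cgG).
Qed.

(** Substituting [y = x z] turns [y^-1 x] into [z^-1], so left invariance suffices. The price is the
    inverse, which explains the [U^-1] in the estimates below. *)
Lemma haar_reflect (x : T) (U : set T) : H x -> open U ->
  mu [set y | U (gmul o (ginv o y) x)] = mu [set y | U (ginv o y)].
Proof.
move=> Hx oU; case: haar_mu => _ _ _ inv.
have mUV : measurable ([set y | U (ginv o y)] : set (borelT T)).
  apply: open_borel; apply: (@open_comp _ _ (ginv o)) oU => y _.
  by case: cgG => _ _ _ _; exact.
rewrite -(inv x _ Hx mUV); congr (mu _); apply/seteqP; split=> y /=.
  move=> Uyx; exists (gmul o (ginv o x) y); last by rewrite (gVKmul grp).
  by rewrite /= !(group_simp grp).
by case=> z Uz <-; rewrite !(group_simp grp).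
Qed.

(* A finite Borel partition subordinate to [W], up to a [mu]-null set; it
   turns an average over the group into a finite convex combination. *)
Lemma haar_partition (W : T -> set T) :
  (forall y, H y -> open (W y)) -> (forall y, H y -> W y y) ->
  exists N (y : nat -> T) (E : nat -> set (borelT T)),
    [/\ forall i, H (y i), forall i, measurable (E i), trivIset setT E,
        forall i, E i `<=` W (y i) & \sum_(i < N) mu (E i) = 1].
Proof.
move=> oW Wy.
have : compact H by exact: (compact_group_compact cgG).
rewrite compact_cover => /(_ _ H W oW)[|D DH HD].
  by move=> y Hy; exists y => //; exact: Wy.
(* The default value [gone o] lies in [H], so [y i] is in [H] for every index, also beyond the
   finite subcover. *)
pose y i := nth (gone o) (enum_fset D) i.
have Hy i : H (y i).
  have [iD|Di] := ltnP i (size (enum_fset D)).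
    by have := DH (y i); rewrite inE; apply; exact: mem_nth.
  by rewrite /y nth_default//; case: sgH.
pose F i : set (borelT T) := W (y i).
have mF i : measurable (F i) by apply: open_borel; exact: oW.
exists (size (enum_fset D)), y, (seqDU F); split => //.
- by move=> i; exact: seqDU_measurable.
- by move=> i; exact: subset_seqDU.
- rewrite -measure_bigsetU; last 2 first.
  + by move=> i; exact: seqDU_measurable.
  + exact: trivIset_seqDU.
  rewrite -bigsetU_seqDU; apply: haar_supp.
    by apply: bigsetU_measurable => i _.
  move=> x /HD[z /= zD Wzx]; rewrite -bigcup_mkord.
  exists (index z (enum_fset D)) => /=; first by rewrite index_mem.
  by rewrite /F /y nth_index.
Qed.

(** Tube lemma: with [x = y0 s], the map [(s, y) -> y^-1 y0 s] is continuous and sends [(s, y0)] to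
    [s], which lies in [U]. Compactness of [S] yields one neighbourhood of [y0] that serves all [s]
    in [S]. *)
Lemma near_translate_sub (S U : set T) (y0 : T) : closed S -> open U ->
    S `<=` U ->
  \forall y \near y0, forall x, S (gmul o (ginv o y0) x) ->
    U (gmul o (ginv o y) x).
Proof.
move=> clS oU SU.
have cS : compact S by exact: (compact_group_compact cgG).
pose P y s := U (gmul o (ginv o y) (gmul o y0 s)).
have : \forall y \near y0, S `<=` P y.
  apply: ((compact_near_coveringP S).1 cS) => s Ss.
  have cf : continuous (fun p : T * T => gmul o (ginv o p.2) (gmul o y0 p.1)).
    apply: (continuous_gmul cgG).
      by apply: (continuous_ginv cgG) => p; exact: cvg_snd.
    by apply: (continuous_gmul cgG) => p; [exact: cvg_cst|exact: cvg_fst].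
  apply: (cf (s, y0)); apply: open_nbhs_nbhs; split => //=.
  by rewrite (gKmul grp); exact: SU.
apply: filterS => y SP x /SP; rewrite /P (gVKmul grp); exact.
Qed.

End Haar.

(** * Integrals of non-negative functions *)

Section Integral.
Context d (X : measurableType d) {R : realType} (mu : {measure set X -> \bar R}).
Local Open Scope ereal_scope.

(* The integral of a non-negative function is a supremum over simple functions,
   so monotonicity needs no measurability. *)
Lemma ge0_le_integral_nonmeas (D : set X) (f g : X -> \bar R) :
  (forall x, D x -> 0 <= f x) -> (forall x, D x -> f x <= g x) ->
  \int[mu]_(x in D) f x <= \int[mu]_(x in D) g x.
Proof.
move=> f0 fg; have g0 x : D x -> 0 <= g x.
  by move=> Dx; exact: le_trans (f0 _ Dx) (fg _ Dx).
rewrite !ge0_integralE//; apply: le_ereal_sup => _ [h hf <-]; exists h => // x.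
apply: le_trans (hf x) _; rewrite /patch; case: ifPn => // /set_mem; exact: fg.
Qed.

Lemma integral_sum_indic N (D : set X) (w : 'I_N -> \bar R)
    (B : 'I_N -> set X) : measurable D ->
  (forall i, 0 <= w i) -> (forall i, measurable (B i)) ->
  \int[mu]_(x in D) (\sum_(i < N) w i * (\1_(B i) x)%:E) =
  \sum_(i < N) w i * mu (B i `&` D).
Proof.
move=> mD w0 mB.
have mI i : measurable_fun D (fun x => (\1_(B i) x)%:E : \bar R).
  by apply/measurable_EFinP; exact: measurable_indic.
rewrite ge0_integral_sum//.
- apply: eq_bigr => i _; rewrite ge0_integralZl ?integral_indic//.
- by move=> i; exact: measurable_funeM.
- by move=> i x _; apply: mule_ge0 => //; rewrite lee_fin.
Qed.

End Integral.

(** Layer-cake approximation with step [d]: the sum is [d] times the number of positive multiples of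
    [d], among the first [N], that do not exceed [t]. *)
Lemma level_count (R : realFieldType) (d t : R) (N : nat) :
  0 <= d -> 0 <= t -> t <= N%:R * d ->
  \sum_(i < N) d * (i.+1%:R * d <= t)%R%:R <= t <=
    d + \sum_(i < N) d * (i.+1%:R * d <= t)%R%:R.
Proof.
move=> d0 t0 tN; under eq_bigr do rewrite mulrC.
rewrite -mulr_suml -natr_sum.
(* For the induction on [N], the disjunction records whether every level so far is at most [t] or
   the count [c] has already stopped growing. *)
suff [cd cM ct] : let c := (\sum_(i < N) (i.+1%:R * d <= t)%R)%N in
    [/\ c%:R * d <= t, (c <= N)%N & c = N \/ t < c.+1%:R * d].
  rewrite cd /=; case: ct => [->|]; first by lra.
  by rewrite -natr1 mulrDl mul1r => /ltW; rewrite addrC.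
rewrite /=; elim: N {tN} => [|M [cd cM ct]].
  by rewrite big_ord0 mul0r; split => //; left.
rewrite big_ord_recr /=; set c := (\sum_(i < M) _)%N in cd cM ct *.
have [Mt|Mt] := leP (M.+1%:R * d) t; rewrite ?addn1 ?addn0.
  case: ct => [cE|tc]; first by rewrite cE; split => //; left.
  have : c.+1%:R * d <= M.+1%:R * d by rewrite ler_wpM2r// ler_nat.
  by move=> /(lt_le_trans tc)/lt_le_trans-/(_ _ Mt); rewrite ltxx.
split => //; first exact: leqW.
by right; case: ct => // ->.
Qed.

(** * Haar measures along a closed correspondence *)

Definition rel_image {T1 T2 : Type} (rho : T1 -> T2 -> Prop) (A : set T1) :
    set T2 := [set y | exists2 x, A x & rho x y].

(** The conditions are symmetric in the two groups, so every inequality along [rho] can be reversed;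
    equality on a single group is an instance. *)
Definition group_corr {T1 T2 : Type} (o1 : group_ops T1) (o2 : group_ops T2)
    (H1 : set T1) (H2 : set T2) (rho : T1 -> T2 -> Prop) :=
  [/\ forall x y x' y', rho x y -> rho x' y' ->
        rho (gmul o1 x x') (gmul o2 y y'),
      forall x y, rho x y -> rho (ginv o1 x) (ginv o2 y),
      forall h, H1 h -> exists2 k, H2 k & rho h k &
      forall k, H2 k -> exists2 h, H1 h & rho h k].

Lemma group_corr_eq {T : Type} (o : group_ops T) H : group_corr o o H H eq.
Proof. by split=> [x _ x' _ <- <-|x _ <-|h Hh|h Hh]//; exists h. Qed.

Lemma group_corr_sym {T1 T2 : Type} (o1 : group_ops T1) (o2 : group_ops T2)
    (H1 : set T1) (H2 : set T2) (rho : T1 -> T2 -> Prop) :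
  group_corr o1 o2 H1 H2 rho -> group_corr o2 o1 H2 H1 (fun y x => rho x y).
Proof.
by case=> rhoM rhoV tot1 tot2; split=> //= [x y x' y'|x y];
  [exact: rhoM|exact: rhoV].
Qed.

Section Average.
Context {R : realType} {T1 T2 : ptopologicalType}.
Context {o1 : group_ops T1} {o2 : group_ops T2} {H1 : set T1} {H2 : set T2}.
Context {mu1 : {measure set (borelT T1) -> \bar R}}.
Context {mu2 : {measure set (borelT T2) -> \bar R}}.
Hypotheses (cg1 : compact_group o1) (cg2 : compact_group o2).
Hypothesis sg2 : is_subgroup o2 H2.
Hypotheses (cl1 : closed H1) (cl2 : closed H2).
Hypotheses (haar1 : haar_on o1 H1 mu1) (haar2 : haar_on o2 H2 mu2).
Context {rho : T1 -> T2 -> Prop} (corr : group_corr o1 o2 H1 H2 rho).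
Let grp1 : is_group o1. Proof. by case: cg1. Qed.
Local Open Scope ereal_scope.

(* Averaging the translates of [A] by suitable finitely many elements of [H1],
   with weights given by [mu2], yields a function bounded on [H1] by the
   right-hand side; its integral against [mu1] is [mu1 A]. *)
Lemma haar_le_reflect (A : set T1) (S U : set T2) :
    closed A -> closed S -> open U -> S `<=` U -> rel_image rho A `<=` S ->
  mu1 A <= mu2 [set y | U (ginv o2 y)].
Proof.
move=> clA clS oU SU AS; case: corr => rhoM rhoV tot1 tot2.
pose W y0 := [set y | forall x, S (gmul o2 (ginv o2 y0) x) ->
  U (gmul o2 (ginv o2 y) x)]°.
have oW y0 : H2 y0 -> open (W y0) by move=> _; exact: open_interior.
have Wy0 y0 : H2 y0 -> W y0 y0 by move=> _; exact: (near_translate_sub cg2).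
have [N [y [E [Hy mE tE EW sumE]]]] := haar_partition cg2 sg2 cl2 haar2 oW Wy0.
have /choice[h hP] : forall i, exists h, H1 h /\ rho h (y i).
  by move=> i; have [h] := tot2 _ (Hy i); exists h.
pose B (i : 'I_N) : set (borelT T1) := gmul o1 (h i) @` A.
have mA : measurable (A : set (borelT T1)) by exact: closed_borel.
have mB i : measurable (B i).
  exact: (measurable_gmul_image cg1).
have muB i : mu1 (B i `&` H1) = mu1 A.
  rewrite (haar_setIH cl1 haar1)//; case: haar1 => _ _ _; apply => //.
  by case: (hP i).
have mH1 : measurable (H1 : set (borelT T1)) by exact: closed_borel.
(* The translates [B i] all have mass [mu1 A], by invariance, and the weights [mu2 (E i)] sum to
   1. *)
have -> : mu1 A = \int[mu1]_(x in H1) \sum_(i < N) mu2 (E i) * (\1_(B i) x)%:E.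
  rewrite integral_sum_indic//; under eq_bigr do rewrite muB.
  by rewrite -ge0_sume_distrl ?sumE ?mul1e.
set c := mu2 _.
have -> : c = \int[mu1]_(x in H1) cst c x.
  by rewrite integral_cst// (haar_supp cl1 haar1) ?mule1.
apply: ge0_le_integral_nonmeas => x Hx.
  by apply: sume_ge0 => i _; apply: mule_ge0 => //; rewrite lee_fin.
(* If [x] lies in [h i A], then [(h i)^-1 x] is in [A] and related to [(y i)^-1 k], which is
   therefore in [S]; hence [E i] lies in the set of [y] with [y^-1 k] in [U]. The [E i] are
   disjoint, and [haar_reflect] gives that set the mass [c]. *)
have [k Hk rxk] := tot1 _ Hx.
rewrite (eq_bigr (fun i => if x \in B i then mu2 (E i) else 0)); last first.
  by move=> i _; rewrite indicE; case: ifP; rewrite ?mule1 ?mule0.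
rewrite -big_mkcond /= -(measure_bigsetU_ord_cond mu2); last 2 first.
- by [].
- by move=> i j _ _ ?; apply/val_inj; exact: tE.
rewrite /= /c -(haar_reflect cg2 haar2 Hk oU); apply: le_measure; rewrite ?inE.
- exact: bigsetU_measurable.
- apply: open_borel; apply: (@open_comp _ _ (fun y => gmul o2 (ginv o2 y) k)) oU.
  move=> z _; apply: (continuous_gmul cg2); last by move=> ?; exact: cvg_cst.
  by apply: (continuous_ginv cg2) => ?; exact: cvg_id.
- rewrite -bigcup_seq_cond => z [i /= /andP[_ /set_mem[a Aa hax]]].
  move=> /EW /interior_subset; apply.
  apply: AS; exists a => //.
  rewrite -(gKmul grp1 (h i) a) hax; apply: rhoM => //.
  by apply: rhoV; case: (hP i).
Qed.

End Average.

(** * Comparison of measures and of lower integrals along the correspondence *)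

Section Transfer.
Context {R : realType} {T1 T2 : ptopologicalType}.
Context {o1 : group_ops T1} {o2 : group_ops T2} {H1 : set T1} {H2 : set T2}.
Context {mu1 : {measure set (borelT T1) -> \bar R}}.
Context {mu2 : {measure set (borelT T2) -> \bar R}}.
Hypotheses (cg1 : compact_group o1) (cg2 : compact_group o2).
Hypothesis sg2 : is_subgroup o2 H2.
Hypotheses (cl1 : closed H1) (cl2 : closed H2).
Hypotheses (haar1 : haar_on o1 H1 mu1) (haar2 : haar_on o2 H2 mu2).
Context {rho : T1 -> T2 -> Prop} (corr : group_corr o1 o2 H1 H2 rho).
Hypothesis closed_rho : forall A, closed A -> closed (rel_image rho A).
Local Open Scope ereal_scope.

Lemma haar_le_image (A : set T1) : closed A -> mu1 A <= mu2 (rel_image rho A).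
Proof.
move=> clA; have clS := closed_rho clA; set S := rel_image rho A in clS *.
have mS : measurable (S : set (borelT T2)) by exact: closed_borel.
apply/lee_addgt0Pr => e e0.
have [V [oV SV muV]] := haar_outer haar2 mS e0.
apply: le_trans (ltW muV).
(* Normality interposes an open [U] with closure [C] such that [S <= U <= C <= V], leaving room for
   one averaging between [S] and [U] and another between the complements of [V] and [C]. *)
have nT2 : normal_space T2 by case: cg2 => _ hT cT _ _; exact: compact_normal.
have [|U0 /set_nbhsP[U [oU SU UU0]] U0V] := nT2 _ clS V.
  by apply/set_nbhsP; exists V; split => //; exact: subset_refl.
pose C := closure U.
have UV : C `<=` V by apply: subset_trans U0V; exact: closureS.
have clC : closed [set y | C (ginv o2 y)].
  apply: (@preimage_closed _ _ (ginv o2) C) => [y _|]; last exact: closed_closure.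
  by case: cg2 => _ _ _ _; exact.
have oUV : open [set y | U (ginv o2 y)].
  apply: (@open_comp _ _ (ginv o2) U) => // y _.
  by case: cg2 => _ _ _ _; exact.
have mC : measurable ([set y | C (ginv o2 y)] : set (borelT T2)).
  exact: closed_borel.
have mV : measurable (V : set (borelT T2)) by exact: open_borel.
apply: (@le_trans _ _ (mu2 [set y | C (ginv o2 y)])).
  apply: le_trans (haar_le_reflect cg1 cg2 sg2 cl1 cl2 haar1 haar2 corr
    clA clS oU SU _) _ => //.
  apply: le_measure; rewrite ?inE//; first exact: open_borel.
  by move=> y /=; exact: subset_closure.
(* Averaging on [G2] alone, on complements, removes the inverse: with total mass 1 it reads
   [mu2 (C^-1) <= mu2 V]. *)
have : mu2 (~` V) <= mu2 [set y | (~` C) (ginv o2 y)].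
  apply: (haar_le_reflect cg2 cg2 sg2 cl2 cl2 haar2 haar2 (@group_corr_eq _ _ _)
    (S := ~` V)).
  - exact: open_closedC.
  - exact: open_closedC.
  - by apply: closed_openC; exact: closed_closure.
  - exact: subsetC.
  - by move=> _ [y Vy <-].
rewrite -[[set y | _]]/(~` [set y | C (ginv o2 y)]).
rewrite !(haar_setC haar2)//.
move: (haar_fin_num haar2 mC) (haar_fin_num haar2 mV) => /fineK <- /fineK <-.
by rewrite -!EFinB !lee_fin => ?; lra.
Qed.

(** A simple function [g] below [phi1] is cut into superlevel sets. Closed sets inside these are
    carried to [G2] by [rho], where they lie under the graph of [phi2], and [haar_le_image] compares
    their masses. *)
Lemma haar_integral_le (phi1 : T1 -> \bar R) (phi2 : T2 -> \bar R) :
    (forall x, H1 x -> 0 <= phi1 x <= 1) ->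
    (forall y, H2 y -> 0 <= phi2 y <= 1) ->
    (forall x y, H1 x -> H2 y -> rho x y -> phi1 x = phi2 y) ->
  \int[mu1]_(x in H1) phi1 x <= \int[mu2]_(y in H2) phi2 y.
Proof.
move=> phi1_01 phi2_01 phi12.
rewrite (ge0_integralE mu1); last by move=> x /phi1_01/andP[].
apply: ge_ereal_sup => _ [g gphi <-].
have g0 x : (0 <= g x)%R by exact: fun_ge0.
(* The integral over [H1] extends [phi1] by 0, so [g] cannot be positive outside [H1]. *)
have gH1 x : (0 < g x)%R -> H1 x.
  move=> gx0; have := gphi x; rewrite /patch; case: ifPn => [/set_mem//|_].
  by rewrite lee_fin leNgt gx0.
have gp x : H1 x -> (g x)%:E <= phi1 x.
  by move=> Hx; have := gphi x; rewrite /patch mem_set.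
have g1 x : (g x <= 1)%R.
  have [->//|gx0] := eqVneq (g x) 0%R.
  have Hx : H1 x by apply: gH1; rewrite lt_def gx0 g0.
  by rewrite -lee_fin; apply: le_trans (gp x Hx) _; case/andP: (phi1_01 x Hx).
apply/lee_addgt0Pr => e e0.
(* With [d = 1/N] the total error is [2d]: one [d] for the bottom layer, and one for [N] inner
   approximations, each of error [d] and weight [d]. *)
have [N N0 Ne] : exists2 N, (0 < N)%N & (2 / N%:R <= e)%R.
  have := truncnS_gt (2 / e)%R; set M := Num.trunc _ => Me.
  exists M.+1 => //; rewrite ler_pdivrMr//; rewrite ltr_pdivrMr// in Me.
  by rewrite mulrC ltW.
pose d : R := (N%:R^-1)%R.
have d0 : (0 < d)%R by rewrite invr_gt0 ltr0n.
have Nd : (N%:R * d = 1)%R by rewrite mulfV// pnatr_eq0 -lt0n.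
pose B (i : nat) : set (borelT T1) := [set x | i%:R * d <= g x]%R.
have mB i : measurable (B i).
  rewrite (_ : B i = g @^-1` `[(i%:R * d)%R, +oo[%classic).
    by rewrite -[X in measurable X]setTI; exact: measurable_funP.
  by apply/seteqP; split=> x /=; rewrite in_itv /= andbT.
have /choice[K KP] : forall i, exists K : set T1,
    [/\ closed K, K `<=` B i.+1 & mu1 (B i.+1) <= mu1 K + d%:E].
  by move=> i; apply: (haar_inner haar1).
have clK i : closed (K i) by case: (KP i).
have KB i : K i `<=` B i.+1 by case: (KP i).
have mK i : measurable (K i : set (borelT T1)) by exact: closed_borel.
pose L (i : nat) : set (borelT T2) := rel_image rho (K i).
have mL i : measurable (L i) by apply: closed_borel; exact: closed_rho.
have mH2 : measurable (H2 : set (borelT T2)) by exact: closed_borel.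
(* A point [y] of [H2] in [L i] is related to some [x] in [K i], so
   [phi2 y = phi1 x >= g x >= (i+1)d]. Starting at level [d > 0] forces [x] into [H1], where [phi1]
   and [phi2] are comparable. *)
have sumL : \sum_(i < N) d%:E * mu2 (L i) <= \int[mu2]_(y in H2) phi2 y.
  have -> : \sum_(i < N) d%:E * mu2 (L i) =
      \int[mu2]_(y in H2) \sum_(i < N) d%:E * (\1_(L i) y)%:E.
    rewrite integral_sum_indic//; last by move=> _; rewrite lee_fin ltW.
    by apply: eq_bigr => i _; rewrite (haar_setIH cl2 haar2).
  apply: ge0_le_integral_nonmeas => y Hy.
    by apply: sume_ge0 => i _; rewrite -EFinM lee_fin mulr_ge0// ltW.
  have /andP[p0 p1] := phi2_01 y Hy.
  have pfin : phi2 y \is a fin_num.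
    by rewrite ge0_fin_numE//; apply: le_lt_trans p1 _; exact: ltry.
  rewrite -(fineK pfin) in p0 p1 *; set t := fine _ in p0 p1 *.
  rewrite !lee_fin in p0 p1.
  have := @level_count _ d t N (ltW d0) p0; rewrite Nd => /(_ p1)/andP[tle _].
  rewrite sumEFin lee_fin; apply: le_trans tle; apply: ler_sum => i _.
  apply: ler_wpM2l; first exact: ltW.
  rewrite indicE ler_nat; case: (boolP (y \in _)) => //.
  move=> /set_mem[x Kx rxy]; have /= dx := KB _ _ Kx.
  have Hx : H1 x by apply: gH1; apply: lt_le_trans dx; rewrite mulr_gt0.
  rewrite (_ : (_ <= t)%R)//; apply: le_trans dx _.
  by rewrite -lee_fin fineK// -(phi12 _ _ Hx Hy rxy); exact: gp.
have dK i : d%:E * mu1 (B i.+1) <= d%:E * mu2 (L i) + (d * d)%:E.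
  rewrite EFinM -muleDr ?fin_num_adde_defl//; apply: lee_wpmul2l.
    by rewrite lee_fin ltW.
  by case: (KP i) => _ _ /le_trans; apply; apply: leeD => //; exact: haar_le_image.
rewrite -integralT_nnsfun.
(* Index 0 supplies the additive [d] of [level_count], since [B 0] is the whole group. *)
apply: (@le_trans _ _ (\sum_(i < N.+1) d%:E * mu1 (B i))).
  have -> : \sum_(i < N.+1) d%:E * mu1 (B i) =
      \int[mu1]_x \sum_(i < N.+1) d%:E * (\1_(B i) x)%:E.
    rewrite integral_sum_indic//; last by move=> _; rewrite lee_fin ltW.
    by apply: eq_bigr => i _; rewrite setIT.
  apply: ge0_le_integral_nonmeas => x _; first by rewrite lee_fin.
  have := @level_count _ d (g x) N (ltW d0) (g0 x); rewrite Nd.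
  move=> /(_ (g1 x))/andP[_]; rewrite sumEFin lee_fin => /le_trans; apply.
  rewrite big_ord_recl /= indicE mem_set ?mulr1; last by rewrite /B /= mul0r.
  rewrite lerD2l; apply: ler_sum => i _; apply: ler_wpM2l; first exact: ltW.
  rewrite indicE ler_nat.
  by case: (boolP (_ <= _)%R) => // ?; rewrite mem_set.
rewrite big_ord_recl /=.
apply: (@le_trans _ _ (d%:E + (\sum_(i < N) d%:E * mu2 (L i) + d%:E))).
  apply: leeD.
    rewrite -[leRHS]mule1; apply: lee_wpmul2l; first by rewrite lee_fin ltW.
    exact: (haar_le1 haar1).
  apply: le_trans (lee_sum _ (fun i _ => dK _)) _.
  rewrite big_split /= leeD2l// sumEFin lee_fin sumr_const card_ord.
  by rewrite -mulr_natl mulrA Nd mul1r.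
rewrite addeCA; apply: leeD => //.
by rewrite -EFinD lee_fin; apply: le_trans Ne; rewrite /d; lra.
Qed.

End Transfer.

(** * Iterated integrals *)

Section IteratedIntegral.
Local Open Scope ereal_scope.

Lemma iint_01 (R : realType) (T : ptopologicalType) (o : group_ops T)
    (H : set T) (mu : {measure set (borelT T) -> \bar R}) k F :
  closed H -> haar_on o H mu -> (forall s, 0 <= F s <= 1) ->
  0 <= iint H mu k F <= 1.
Proof.
move=> clH haar_mu; elim: k F => [|k IHk] F F01 /=; first exact: F01.
have I01 h : 0 <= iint H mu k (fun s => F (h :: s)) <= 1 by exact: IHk.
apply/andP; split; first by apply: integral_ge0 => h _; case/andP: (I01 h).
apply: le_trans (ge0_le_integral_nonmeas (g := cst 1) _ _ _) _.
- by move=> h _; case/andP: (I01 h).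
- by move=> h _; case/andP: (I01 h).
- have mH : measurable (H : set (borelT T)) by exact: closed_borel.
  by rewrite integral_cst// (haar_supp clH haar_mu)// mule1.
Qed.

(** Induction on the number of variables: for related first entries the inner integrals agree by the
    induction hypothesis, and [haar_integral_le] applies to the outer one in both directions. *)
Lemma iint_corr (R : realType) (T1 T2 : ptopologicalType)
    (o1 : group_ops T1) (o2 : group_ops T2) (H1 : set T1) (H2 : set T2)
    (mu1 : {measure set (borelT T1) -> \bar R})
    (mu2 : {measure set (borelT T2) -> \bar R}) (rho : T1 -> T2 -> Prop)
    (k : nat) (F1 : seq T1 -> \bar R) (F2 : seq T2 -> \bar R) :
  compact_group o1 -> compact_group o2 ->
  is_subgroup o1 H1 -> closed H1 -> is_subgroup o2 H2 -> closed H2 ->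
  haar_on o1 H1 mu1 -> haar_on o2 H2 mu2 ->
  group_corr o1 o2 H1 H2 rho ->
  (forall A, closed A -> closed (rel_image rho A)) ->
  (forall A, closed A -> closed (rel_image (fun y x => rho x y) A)) ->
  (forall s, 0 <= F1 s <= 1) -> (forall s, 0 <= F2 s <= 1) ->
  (forall hs ks, size hs = k -> size ks = k -> all_in H1 hs -> all_in H2 ks ->
    (forall i, (i < k)%N -> rho (nth (gone o1) hs i) (nth (gone o2) ks i)) ->
    F1 hs = F2 ks) ->
  iint H1 mu1 k F1 = iint H2 mu2 k F2.
Proof.
move=> cg1 cg2 sg1 cl1 sg2 cl2 haar1 haar2 corr cl_rho cl_rho'.
elim: k F1 F2 => [|k IHk] F1 F2 F1_01 F2_01 F12 /=; first exact: F12.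
pose phi1 h := iint H1 mu1 k (fun s => F1 (h :: s)).
pose phi2 h := iint H2 mu2 k (fun s => F2 (h :: s)).
have phi1_01 h : H1 h -> 0 <= phi1 h <= 1 by move=> _; exact: iint_01 haar1 _.
have phi2_01 h : H2 h -> 0 <= phi2 h <= 1 by move=> _; exact: iint_01 haar2 _.
have phi12 x y : H1 x -> H2 y -> rho x y -> phi1 x = phi2 y.
  move=> Hx Hy rxy; apply: IHk => // hs ks shs sks Hhs Hks rhk.
  by apply: F12 => /=; rewrite ?shs ?sks// => -[|i] //=; exact: rhk.
apply/eqP; rewrite eq_le; apply/andP; split.
  exact: (haar_integral_le cg1 cg2 sg2 cl1 cl2 haar1 haar2 corr cl_rho).
apply: (haar_integral_le cg2 cg1 sg1 cl2 cl1 haar2 haar1 (group_corr_sym corr)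
  cl_rho') => // y x Hy Hx rxy.
exact/esym/phi12.
Qed.

End IteratedIntegral.

(** * Isoclinism *)

Section Isoclinism.
Context {T1 T2 : ptopologicalType} {o1 : group_ops T1} {o2 : group_ops T2}.
Context {Z1 : set T1} {Z2 : set T2} {alpha : T1 -> T2}.
Hypotheses (cg1 : compact_group o1) (cg2 : compact_group o2).
Hypotheses (nZ1 : normal_subgroup (o := o1) Z1).
Hypotheses (nZ2 : normal_subgroup (o := o2) Z2).
Hypotheses (cl1 : closed Z1) (cl2 : closed Z2).
Hypothesis alphaE : forall x y,
  cong_mod o1 Z1 x y <-> cong_mod o2 Z2 (alpha x) (alpha y).
Hypothesis alpha_onto : forall y, exists x, cong_mod o2 Z2 (alpha x) y.
Hypothesis alphaM : forall x y, cong_mod o2 Z2 (alpha (gmul o1 x y))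
  (gmul o2 (alpha x) (alpha y)).
Let grp1 : is_group o1. Proof. by case: cg1. Qed.
Let grp2 : is_group o2. Proof. by case: cg2. Qed.
Let rho x y := cong_mod o2 Z2 (alpha x) y.

Lemma quotient_iso_corr (H1 : set T1) (H2 : set T2) :
  (forall h, H1 h -> exists2 k, H2 k & rho h k) ->
  (forall k, H2 k -> exists2 h, H1 h & rho h k) ->
  group_corr o1 o2 H1 H2 rho.
Proof.
move=> tot1 tot2.
have rhoM x y x' y' : rho x y -> rho x' y' ->
    rho (gmul o1 x x') (gmul o2 y y').
  move=> rxy rxy'; apply: (cong_mod_trans grp2 nZ2) (alphaM _ _) _.
  exact: (cong_modM grp2 nZ2).
split=> // x y rxy.
have rxV : rho (ginv o1 x) (alpha (ginv o1 x)) by exact: (cong_mod_refl grp2 nZ2).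
(* Multiplicativity at [(1,1)] puts [alpha 1] in [Z2]. As [alpha 1] is congruent to [y u], the
   latter is in [Z2] too, which makes [u] congruent to [y^-1]. *)
set u := alpha _ in rxV.
have := rhoM _ _ _ _ rxy rxV; rewrite (gmulV grp1).
have := alphaM (gone o1) (gone o1); rewrite (gmul1 grp1).
rewrite {1}/cong_mod (gKmul grp2) => Z1' r1.
apply: (cong_mod_trans grp2 nZ2) rxV _.
case: nZ2 => -[_ ZM ZV] _.
have /ZV : Z2 (gmul o2 y u).
  by have := ZM _ _ Z1' r1; rewrite (gVKmul grp2).
by rewrite /cong_mod (ginvM grp2).
Qed.

(** Saturating [A] to the closed set [A Z1] does not change its image, and [alpha] carries the open
    saturated complement of [A Z1] onto the complement of that image. *)
Lemma quotient_iso_closed :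
  (forall U : set T1, open U -> saturated o1 Z1 U ->
     open [set y | exists2 x, U x & rho x y]) ->
  forall A, closed A -> closed (rel_image rho A).
Proof.
move=> alpha_open A clA; rewrite -[rel_image rho A]setCK; apply: open_closedC.
pose AZ := [set x | exists2 a, A a & cong_mod o1 Z1 a x].
rewrite (_ : ~` _ = [set y | exists2 x, (~` AZ) x & rho x y]).
  apply: alpha_open; first exact/closed_openC/(closed_cong_mod cg1).
  move=> x y xy nAx [a Aa ay]; apply: nAx; exists a => //.
  exact/(cong_mod_trans grp1 nZ1 ay)/(cong_mod_sym grp1 nZ1).
apply/seteqP; split=> y /= nA.
  have [x rxy] := alpha_onto y; exists x => // -[a Aa /alphaE ax].
  by apply: nA; exists a => //; exact: (cong_mod_trans grp2 nZ2) ax rxy.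
move=> [a Aa ray]; case: nA => x nAx rxy; apply: nAx; exists a => //.
apply/alphaE; apply: (cong_mod_trans grp2 nZ2) ray _.
exact: (cong_mod_sym grp2 nZ2).
Qed.

(** The inverse image of [A] under [rho] is the preimage of the closed set [A Z2] under [alpha]. *)
Lemma quotient_iso_closedV :
  (forall V : set T2, open V -> saturated o2 Z2 V -> open (alpha @^-1` V)) ->
  forall A, closed A -> closed (rel_image (fun y x => rho x y) A).
Proof.
move=> alpha_cont A clA; rewrite -[rel_image _ A]setCK; apply: open_closedC.
pose AZ := [set x | exists2 a, A a & cong_mod o2 Z2 a x].
rewrite (_ : ~` _ = alpha @^-1` (~` AZ)).
  apply: alpha_cont; first exact/closed_openC/(closed_cong_mod cg2).
  move=> x y xy nAx [a Aa ay]; apply: nAx; exists a => //.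
  exact/(cong_mod_trans grp2 nZ2 ay)/(cong_mod_sym grp2 nZ2).
by apply/seteqP; split=> x /= nA [a Aa] r; apply: nA; exists a => //;
  exact: (cong_mod_sym grp2 nZ2).
Qed.

End Isoclinism.

Theorem theorem1p1 (R : realType) (n : nat) (T1 T2 : ptopologicalType)
    (o1 : group_ops T1) (o2 : group_ops T2) (H1 : set T1) (H2 : set T2)
    (muH1 muG1 : {measure set (borelT T1) -> \bar R})
    (muH2 muG2 : {measure set (borelT T2) -> \bar R}) :
  (1 <= n)%N ->
  compact_group o1 -> compact_group o2 ->
  is_subgroup o1 H1 -> closed H1 -> is_subgroup o2 H2 -> closed H2 ->
  haar_on o1 H1 muH1 -> haar_on o1 [set: T1] muG1 ->
  haar_on o2 H2 muH2 -> haar_on o2 [set: T2] muG2 ->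
  rel_n_isoclinic n o1 H1 o2 H2 ->
  rel_nilp_degree o1 n H1 muH1 muG1 = rel_nilp_degree o2 n H2 muH2 muG2.
Proof.
move=> _ cg1 cg2 sg1 cl1 sg2 cl2 haarH1 haarG1 haarH2 haarG2.
have [grp1 grp2] : is_group o1 /\ is_group o2 by case: cg1; case: cg2.
case=> alpha [beta [beta' [[alphaE alpha_onto alphaM] [alphaH alphaHV]
  [alpha_cont alpha_open] [[_ _ betaK _ betaM] _] beta_comm]]].
pose rho x y := cong_mod o2 (upper_central o2 n) (alpha x) y.
have nZ1 := upper_central_normal grp1 n; have nZ2 := upper_central_normal grp2 n.
have clZ1 := upper_central_closed cg1 (n := n).
have clZ2 := upper_central_closed cg2 (n := n).
have corrH : group_corr o1 o2 H1 H2 rho by exact: (quotient_iso_corr cg1 cg2).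
(* The same relation serves the outer integrals over [H1] and [H2] and, here with the whole groups,
   the innermost measures [muG1] and [muG2]. *)
have corrG : group_corr o1 o2 setT setT rho.
  apply: (quotient_iso_corr cg1 cg2) => // [x _|y _].
    by exists (alpha x) => //; exact: (cong_mod_refl grp2).
  by have [x] := alpha_onto y; exists x.
have cl_rho A : closed A -> closed (rel_image rho A).
  exact: (quotient_iso_closed cg1 cg2 nZ1 nZ2).
have cl_rho' A : closed A -> closed (rel_image (fun y x => rho x y) A).
  exact: (quotient_iso_closedV cg2 nZ2).
have sgT (T : Type) (o : group_ops T) : is_subgroup o setT by [].
have E01 (T : ptopologicalType) (o : group_ops T)
    (mu : {measure set (borelT T) -> \bar R}) hs :
    compact_group o -> haar_on o setT mu ->
    (0 <= mu [set g | commn o hs g = gone o] <= 1)%E.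
  move=> cg haar; rewrite measure_ge0 /=; apply: (haar_le1 haar).
  by apply: closed_borel; exact: (closed_commn_eq1 cg).
apply: (iint_corr cg1 cg2 sg1 cl1 sg2 cl2 haarH1 haarH2 corrH cl_rho cl_rho')
  => [s|s|hs ks shs sks Hhs Hks hk].
- exact: E01.
- exact: E01.
set E1 := [set g : borelT T1 | _]; set E2 := [set g : borelT T2 | _].
have clE1 : closed (E1 : set T1) by exact: (closed_commn_eq1 cg1).
have clE2 : closed (E2 : set T2) by exact: (closed_commn_eq1 cg2).
have C1 : commH o1 n H1 (gone o1) by move=> K [].
have beta1 : beta (gone o1) = gone o2.
  have := betaM _ _ C1 C1; rewrite (gmul1 grp1) => b1.
  by rewrite -(gKmul grp2 (beta (gone o1)) (beta (gone o1))) -b1 (gVmul grp2).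
(* Forward because [beta] fixes the identity, backward because it is injective on the commutator
   subgroup. *)
have E12 g g' : rho g g' -> E1 g <-> E2 g'.
  move=> /(beta_comm hs g ks g' shs sks Hhs Hks hk); rewrite /E1 /E2 /= => <-.
  split=> [->//|bc]; rewrite -(betaK _ C1) beta1 -bc betaK//.
  by move=> K _; apply; exists hs, g.
apply/eqP; rewrite eq_le; apply/andP; split.
  apply: le_trans (haar_le_image cg1 cg2 (sgT _ o2) closedT closedT haarG1
    haarG2 corrG cl_rho clE1) _.
  have mE2 : measurable E2 by exact: closed_borel.
  apply: le_measure; rewrite ?inE//; first by apply: closed_borel; exact: cl_rho.
  by move=> y [x E1x /E12[+ _]]; exact.
apply: le_trans (haar_le_image cg2 cg1 (sgT _ o1) closedT closedT haarG2
  haarG1 (group_corr_sym corrG) cl_rho' clE2) _.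
have mE1 : measurable E1 by exact: closed_borel.
apply: le_measure; rewrite ?inE//; first by apply: closed_borel; exact: cl_rho'.
by move=> x [y E2y /E12[_ +]]; exact.
Qed.
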